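(* Let $f \in L^1(\mathbb{R})$ be a function that is not almost everywhere zero, and let $C>1$ be a real number. Then, with $N$ ranging over the natural numbers, $$\lim_{N\rightarrow \infty} \frac{ \left|\left\{x\in \mathbb{R}:|x|\leq N, \ \mathcal{T}f(x) \leq \frac{|x|}{C}\right\}\right|} {N}=0,$$ where $|E|$ denotes the Lebesgue measure of a set $E\subseteq\mathbb{R}$.
   Context: For $f\in L^1(\mathbb{R})$, $x\in\mathbb{R}$ and $r>0$, put $\mathcal{A}_r f(x):=\frac{1}{2r}\int_{-r}^{r} f(x+y)\,dy$. The (centered) Hardy-Littlewood maximal function is $\mathcal{M}f(x):=\sup_{r>0}\mathcal{A}_r|f|(x)\in[0,\infty]$. Put $E_{f,x}:=\{r>0:\mathcal{M}f(x)=\mathcal{A}_r|f|(x)\}$. The frequency function of $f$ is $\mathcal{T}f(x):=\inf E_{f,x}$ if $E_{f,x}$ is nonempty, and $\mathcal{T}f(x):=0$ otherwise. *)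

(* Defs.v *)
From HB Require Import structures.
From mathcomp Require Import all_boot all_order all_algebra.
From mathcomp Require Import all_classical all_reals all_analysis.
From mathcomp Require Import measurable_realfun ring.

Set Implicit Arguments.
Unset Strict Implicit.
Unset Printing Implicit Defensive.
Import Order.TTheory GRing.Theory Num.Theory.
Import numFieldNormedType.Exports.

Local Open Scope classical_set_scope.
Local Open Scope ring_scope.

Section frequency_function.
Context {R : realType}.
Local Notation mu := (@lebesgue_measure R).
Implicit Types (f : R -> R) (x r : R).

Definition average r f x : \bar R :=
  (((2 * r)^-1)%:E * \int[mu]_(y in `[(- r)%R, r]) (f (x + y))%:E)%E.

(* Where HL_maximal f x = +oo this is empty for integrable f, since then all
   the averages are finite. *)
Definition extremal_radii f x : set R :=
  [set r | 0 < r /\ HL_maximal f x = average r (fun y => `|f y|) x].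

Definition frequency_function f x : R :=
  if `[< extremal_radii f x !=set0 >] then inf (extremal_radii f x) else 0.

(* HL_maximal is defined through averages over the open balls centered at x;
   it is the supremum of the averages above. *)
Lemma HL_maximal_average f x : measurable_fun setT f ->
  HL_maximal f x =
  ereal_sup [set average r (fun y => `|f y|) x | r in `]0, +oo[%classic].
Proof.
move=> mf.
pose T := measurableTypeR R.
pose phi : T -> T := fun y : R => x + y.
have mphi : measurable_fun [set: T] phi by exact: measurable_funD.
pose nu : {measure set T -> \bar R} :=
  measure_function_pushforward__canonical__measure_function_Measure mu mphi.
have muE A : measurable A -> mu A = pushforward mu phi A.
  apply: (@lebesgue_measure_unique R nu) => _ [[a b] _ <-] /=.
  rewrite /nu /= /pushforward.
  have -> : phi @^-1` `]a, b] = `]a - x, b - x]%classic.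
    by apply/seteqP; split => y; rewrite /phi /= !in_itv/= ltrBlDl lerBrDl.
  rewrite !lebesgue_measure_itv/= !lte_fin ltrD2r.
  case: ifP => // _; rewrite -!EFinB opprB; congr (_%:E); ring.
congr ereal_sup; apply: eq_imagel => r; rewrite /= in_itv/= andbT => r0.
rewrite /iavg /average lebesgue_measure_ball ?ltW// inver.
rewrite gt_eqF ?mulrn_wgt0// mulr_natl; congr (_ * _)%E.
pose g : T -> \bar R := fun y => `|f y|%:E.
have mg : measurable_fun [set: T] (g : T -> \bar R).
  by apply/measurable_EFinP; exact: measurableT_comp.
transitivity (\int[nu]_(y in ball x r) g y)%E.
  by apply: eq_measure_integral => A mA _; exact: muE.
rewrite ge0_integral_pushforward//; last 3 first.
- exact: measurable_ball.
- exact: measurable_funTS.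
- by move=> y _; rewrite lee_fin.
have -> : phi @^-1` ball x r = `]- r, r[%classic.
  by rewrite ball_itv; apply/seteqP; split => y; rewrite /phi /= !in_itv/= !ltrD2l.
have mgphi : measurable_fun [set: T] (g \o phi) by exact: measurableT_comp.
rewrite integral_itv_bndoo; last exact: measurable_funTS.
by rewrite [RHS]integral_itv_bndoo//; exact: measurable_funTS.
Qed.

End frequency_function.

(* Main.v *)
Require Import Defs.
From HB Require Import structures.
From mathcomp Require Import all_boot all_order all_algebra.
From mathcomp Require Import all_classical all_reals all_analysis.
From mathcomp Require Import measurable_realfun ring lra.

Set Implicit Arguments.
Unset Strict Implicit.
Unset Printing Implicit Defensive.

Import Order.TTheory GRing.Theory Num.Theory.
Import numFieldNormedType.Exports.
Local Open Scope classical_set_scope.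
Local Open Scope ring_scope.

(** The mass of f near the origin keeps the maximal function from decaying
    faster than 1/|x|: once a bounded ball carries mass more than m > 0, the
    average over the ball of radius 2|x| gives Mf(x) > m/(4|x|) for |x| large
    ([HL_maximal_lower_bound]).

    Suppose now that the frequency function at x is at most |x|/C. Then some
    radius r at most (1 - k)|x|, where 1/C < 1 - k < 1, has an average larger
    than m/(4|x|) ([small_radius]). When some radius attains Mf(x), this is the
    definition of the infimum. When none does, it holds because the averages
    are continuous in r > 0 and tend to 0 at infinity: if all small radii had
    averages at most m/(4|x|), the supremum would be attained at a large one
    ([extremal_radii_nonempty]).

    The window [x - r, x + r] of such a radius stays at distance k|x| from the
    origin, so it only sees the tail of f. Hence every such x with
    d N <= |x| <= N lies in the set where the maximal function of
    f 1_{|y| >= k d N} exceeds m/(4N). By the weak-type (1,1) inequality this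
    set has measure at most (12 N/m) times the integral of |f| over
    |y| >= k d N, which is o(N) because f is integrable. The points with
    |x| < d N contribute at most 2 d N, and d is arbitrary. *)

(** * Lebesgue measure and integrals over centered intervals *)

(** As a function on arbitrary subsets [lebesgue_measure] is an outer measure, so
    the sublevel sets of the frequency function can be estimated without
    knowing that they are measurable. *)
Lemma lebesgue_measure_le (R : realType) (A B : set R) : A `<=` B ->
  (@lebesgue_measure R A <= @lebesgue_measure R B)%E.
Proof. exact: (@le_outer_measure _ _ (mu_ext (@wlength R idfun))). Qed.

(** Lebesgue measure equals its image under y |-> x + y, since the two agree on
    the half-open intervals that generate the Borel sets. *)
Lemma integrable_translate (R : realType) (f : R -> R) (x : R) :
  (@lebesgue_measure R).-integrable [set: R] (EFin \o f) ->
  (@lebesgue_measure R).-integrable [set: R] (EFin \o (fun y => f (x + y))).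
Proof.
pose T := measurableTypeR R; pose phi : T -> T := fun y : R => x + y.
have mphi : measurable_fun [set: T] phi by exact: measurable_funD.
move=> /integrableP[mf foo]; apply/integrableP; split.
  exact: (measurableT_comp mf mphi).
apply: le_lt_trans foo.
pose nu : {measure set T -> \bar R} :=
  measure_function_pushforward__canonical__measure_function_Measure
    (@lebesgue_measure R) mphi.
have muE A : measurable A -> lebesgue_measure A = nu A.
  apply: (@lebesgue_measure_unique R nu) => _ [[a b] _ <-] /=.
  rewrite /nu/= /pushforward.
  have -> : phi @^-1` `]a, b] = `]a - x, b - x]%classic.
    by apply/seteqP; split => y; rewrite /phi/= !in_itv/= ltrBlDl lerBrDl.
  by rewrite !lebesgue_measure_itv/= !lte_fin ltrD2r -!EFinB opprB subrKA.
rewrite [leRHS](eq_measure_integral nu); last by move=> A mA _; exact: muE.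
rewrite ge0_integral_pushforward//; last first.
  by apply: measurableT_comp.
Qed.

(** Changing r to s changes the domain by a set of measure 2|r - s|, and the
    integral of |g| over sets of small measure is small. *)
Lemma continuous_integral_centered (R : realType) (g : R -> R) (a b : R) :
  0 < a ->
  (@lebesgue_measure R).-integrable [set: R] (EFin \o g) ->
  {within `[a, b], continuous
    (fun r : R => \int[@lebesgue_measure R]_(y in `[- r, r]) `|g y|)}.
Proof.
move=> a0 intg.
have intng : (@lebesgue_measure R).-integrable [set: R] (EFin \o (fun y => `|g y|)).
  exact: (integrable_norm intg).
have intI r : (@lebesgue_measure R).-integrable `[-r, r] (EFin \o (fun y => `|g y|)).
  exact: integrableS intng.
apply: continuous_in_subspaceT => r /[!inE]/= /[!in_itv]/= /andP[ar _].
have r0 : 0 < r by exact: lt_le_trans ar.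
apply/cvgrPdist_lt => e e0.
have [d [d0 dP]] := integral_normr_continuous intg e0.
have key s t : 0 < s -> s <= t -> t - s < d / 2 ->
    `|\int[@lebesgue_measure R]_(y in `[- t, t]) `|g y| -
      \int[@lebesgue_measure R]_(y in `[- s, s]) `|g y| | < e.
  move=> s0 st tsd.
  have sub : `[- s, s] `<=` `[- t, t].
    by apply: subset_itv; rewrite bnd_simp ?lerN2.
  have eqU : `[- t, t]%classic = `[- s, s] `|` (`[-t, t] `\` `[- s, s]).
    by rewrite setDUK.
  have mD : measurable (`[-t, t] `\` `[- s, s] : set R) by exact: measurableD.
  rewrite [X in X - _](_ : _ =
      \int[@lebesgue_measure R]_(y in `[- s, s]) `|g y| +
      \int[@lebesgue_measure R]_(y in `[-t, t] `\` `[- s, s]) `|g y|); last first.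
    rewrite {1}eqU Rintegral_setU//.
    - by rewrite -eqU; exact: intI.
    - by apply/disj_set2P; rewrite setDE setICA setICr setI0.
  rewrite addrAC subrr add0r ger0_norm; last exact: Rintegral_ge0.
  apply: dP => //.
  rewrite measureD//=; last first.
    by rewrite lebesgue_measure_itv/=; case: ifP => _; rewrite -?EFinB ltry.
  rewrite setIidr// !lebesgue_measure_itv/= !lte_fin !ifT ?gtrN//; last first.
    exact: lt_le_trans st.
  by rewrite -!EFinB lte_fin; lra.
have d20 : 0 < d / 2 by rewrite divr_gt0.
near=> s.
have s0 : 0 < s by near: s; exact: lt_nbhsr.
have [sd1 sd2] : r - s < d / 2 /\ s - r < d / 2.
  have : `|r - s| < d / 2 by near: s; exists (d / 2).
  by rewrite ltr_norml => /andP[]; lra.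
have [sr|rs] := leP s r; first exact: key.
by rewrite distrC; apply: key => //; exact: ltW.
Unshelve. all: by end_near. Qed.

(** * Averages and the maximal function *)

Lemma average_fin (R : realType) (f : R -> R) (x r : R) :
  (@lebesgue_measure R).-integrable [set: R] (EFin \o f) ->
  average r (fun y => `|f y|) x =
  ((2 * r)^-1 * \int[@lebesgue_measure R]_(y in `[- r, r]) `|f (x + y)|)%:E.
Proof.
move=> /(integrable_translate x) /integrable_norm intf.
rewrite /average EFinM; congr (_ * _)%E; rewrite fineK//.
by apply: integrable_fin_num => //; exact: integrableS intf.
Qed.

(** Beyond a radius K the averages are at most ||f||_1 / (2r) <= l, up to rho
    they are at most l by hypothesis, and some average exceeds l. So the
    supremum is the maximum of a continuous function over [rho, K]. *)
Lemma extremal_radii_nonempty (R : realType) (f : R -> R) (x l rho : R) :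
  (@lebesgue_measure R).-integrable [set: R] (EFin \o f) ->
  0 < l -> 0 < rho ->
  (forall r, 0 < r -> r <= rho -> (average r (fun y => `|f y|%R) x <= l%:E)%E) ->
  (l%:E < HL_maximal f x)%E ->
  extremal_radii f x !=set0.
Proof.
move=> intf l0 rho0 small.
have mf : measurable_fun setT f by case/integrableP : intf => /measurable_EFinP.
rewrite /extremal_radii HL_maximal_average//.
have intg := integrable_translate x intf.
have intng := integrable_norm intg.
pose g y := f (x + y).
pose phi r := \int[@lebesgue_measure R]_(y in `[- r, r]) `|g y|.
pose A r := (2 * r)^-1 * phi r.
have AE r : average r (fun y => `|f y|) x = (A r)%:E by rewrite average_fin.
pose B := \int[@lebesgue_measure R]_(y in setT) `|g y|.
have AB r : 0 < r -> A r <= (2 * r)^-1 * B.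
  move=> r0; rewrite /A ler_pM2l ?invr_gt0 ?mulr_gt0//.
  rewrite /phi /B /Rintegral fine_le//.
  - by apply: integrable_fin_num => //; exact: integrableS intng.
  - exact: integrable_fin_num.
  - by apply: ge0_subset_integral => //; case/integrableP : intng.
move=> /ereal_sup_gt[_ [r0 + <-]]; rewrite /= in_itv/= andbT => r00.
rewrite AE lte_fin => lA.
have rho_r0 : rho < r0.
  rewrite ltNge; apply/negP => r0rho.
  by have := small _ r00 r0rho; rewrite AE lee_fin leNgt lA.
pose K := Num.max r0 (B / (2 * l)).
have far r : K < r -> A r <= l.
  rewrite gt_max => /andP[r0r]; rewrite ltr_pdivrMr ?mulr_gt0// => Br.
  have rp : 0 < r by exact: lt_trans r0r.
  apply: (le_trans (AB _ rp)).
  rewrite mulrC ler_pdivrMr ?mulr_gt0//.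
  by rewrite (_ : l * (2 * r) = r * (2 * l)); [exact: ltW|ring].
have rhoK : rho <= K by rewrite le_max ltW.
have cA : {within `[rho, K], continuous A}.
  move=> r; apply: cvgM; last first.
    exact: continuous_integral_centered.
  move: r; apply: continuous_in_subspaceT => r /[!inE]/= /[!in_itv]/= /andP[rhor _].
  have rp : 0 < r by exact: lt_le_trans rhor.
  apply: cvgV; first by rewrite gt_eqF// mulr_gt0.
  by apply: cvgMr; exact: cvg_id.
have [c] := EVT_max rhoK cA.
rewrite in_itv/= => /andP[rhoc cK] maxc.
have c0 : 0 < c by exact: lt_le_trans rhoc.
have lAc : l <= A c.
  apply: (le_trans (ltW lA)); apply: maxc.
  by rewrite in_itv/= (ltW rho_r0) le_max lexx.
exists c; split => //.
apply/eqP; rewrite eq_le; apply/andP; split; last first.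
  by apply: ereal_sup_ubound; exists c => //=; rewrite in_itv/= c0.
apply: ge_ereal_sup => _ [r + <-]; rewrite /= in_itv/= andbT => rp.
rewrite !AE lee_fin.
have [rrho|rhor] := leP r rho.
  by apply: le_trans lAc; have := small _ rp rrho; rewrite AE lee_fin.
have [rK|Kr] := leP r K.
  by apply: maxc; rewrite in_itv/= (ltW rhor).
by apply: le_trans lAc; exact: far.
Qed.

(** When no radius attains the supremum the frequency function is 0 by
    convention and says nothing by itself; the radius then comes from the
    contrapositive of [extremal_radii_nonempty]. *)
Lemma small_radius (R : realType) (f : R -> R) (x l rho : R) :
  (@lebesgue_measure R).-integrable [set: R] (EFin \o f) ->
  0 < l -> 0 < rho -> frequency_function f x < rho ->
  (l%:E < HL_maximal f x)%E ->
  exists r, [/\ 0 < r, r <= rho & (l%:E < average r (fun y => `|f y|%R) x)%E].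
Proof.
move=> intf l0 rho0 frho lM.
have [E0|E0] := pselect (extremal_radii f x !=set0).
  move: frho; rewrite /frequency_function asboolT// => /(inf_lt E0)[r [r0 Mr]] rrho.
  by exists r; split => //; [exact: ltW|rewrite -Mr].
apply: contrapT => small; apply: E0.
apply: (extremal_radii_nonempty intf l0 rho0 _ lM) => r r0 rrho.
by rewrite leNgt; apply/negP => lr; apply: small; exists r.
Qed.

(** The ball of radius 2|x| around x has measure 4|x| and contains the ball of
    radius |x| around the origin. *)
Lemma HL_maximal_lower_bound (R : realType) (f : R -> R) (x a m : R) :
  measurable_fun [set: R] f -> 0 < `|x| -> a <= `|x| ->
  (m%:E < \int[@lebesgue_measure R]_(y in ball 0%R a) `|f y|%:E)%E ->
  ((m / (4 * `|x|))%:E < HL_maximal f x)%E.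
Proof.
move=> mf x0 ax am.
have r0 : 0 < 2 * `|x| by rewrite mulr_gt0.
apply: (@lt_le_trans _ _ (iavg f (ball x (2 * `|x|)))); last first.
  by apply: ereal_sup_ubound; exists (2 * `|x|) => //=; rewrite in_itv/= r0.
rewrite /iavg lebesgue_measure_ball ?ltW// inver gt_eqF ?mulrn_wgt0//.
rewrite mulrC EFinM (_ : 2 * `|x| *+ 2 = 4 * `|x|); last by ring.
rewrite lte_pmul2l ?lte_fin ?invr_gt0 ?mulr_gt0//.
apply: (lt_le_trans am); apply: ge0_subset_integral.
- exact: measurable_ball.
- exact: measurable_ball.
- apply: measurable_funTS; apply/measurable_EFinP; exact: measurableT_comp.
- by move=> y _; rewrite lee_fin.
- move=> y; rewrite /ball/= sub0r normrN => ya.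
  rewrite (le_lt_trans (ler_normB _ _))//.
  rewrite mulr_natl mulr2n ltrD2l; exact: lt_le_trans ya ax.
Qed.

(** The average over a window only depends on f inside the window. This is what
    lets the weak-type inequality be applied to a tail of f. *)
Lemma average_restrict_le_HL (R : realType) (f : R -> R) (x r : R) (D : set R) :
  measurable_fun [set: R] f -> measurable D -> 0 < r ->
  `[x - r, x + r] `<=` D ->
  (average r (fun y => `|f y|%R) x <= HL_maximal (f \_ D) x)%E.
Proof.
move=> mf mD r0 sub.
have mfD : measurable_fun setT (f \_ D).
  by apply/(measurable_restrictT _ mD); exact: measurable_funTS.
rewrite (HL_maximal_average x mfD).
apply: ereal_sup_ubound; exists r; first by rewrite /= in_itv/= r0.
rewrite /average; congr (_ * _)%E; apply: eq_integral => y.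
rewrite inE/= in_itv/= => /andP[ry yr].
rewrite patchE ifT// inE; apply: sub; rewrite /= in_itv/=.
by rewrite !lerD2l ry yr.
Qed.

(** * The mass of f near the origin and at infinity *)

Lemma tail_integral_cvg0 (R : realType) (f : R -> R) (a : R) : 0 < a ->
  (@lebesgue_measure R).-integrable [set: R] (EFin \o f) ->
  (\int[@lebesgue_measure R]_x (`|(f \_ (~` ball 0%R (a * n%:R)%R)) x|)%:E)%E
    @[n --> \oo] --> 0%E.
Proof.
move=> a0 intf.
have mf : measurable_fun setT f by case/integrableP : intf => /measurable_EFinP.
have mD n : measurable (~` ball (0 : R) (a * n%:R)).
  by apply: measurableC; exact: measurable_ball.
have mfD n : measurable_fun setT (f \_ (~` ball (0 : R) (a * n%:R))).
  by apply/(measurable_restrictT _ (mD n)); exact: measurable_funTS.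
have [||||| _ _ ] :=
  @dominated_convergence _ _ R (@lebesgue_measure R) setT measurableT
  (fun n x => (`|(f \_ (~` ball (0 : R) (a * n%:R))) x|)%:E) (cst 0%E)
  (fun x => (`|f x|)%:E).
- move=> n; apply/measurable_EFinP.
  exact: (measurableT_comp (@normr_measurable R setT) (mfD n)).
- exact: measurable_cst.
- apply: aeW => x _; apply: cvg_near_cst; near=> n.
  have xB : ball (0 : R) (a * n%:R) x.
    rewrite /ball/= sub0r normrN -ltr_pdivrMl//; near: n.
    exact: nbhs_infty_gtr.
  by rewrite patchE memNset ?normr0//= => /(_ xB).
- exact: integrable_norm.
- apply: aeW => x n _; rewrite patchE /= normr_id lee_fin.
  by case: ifP => // _; rewrite normr0.
by rewrite integral0.
Unshelve. all: by end_near. Qed.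

Lemma ball_with_positive_mass (R : realType) (f : R -> R) :
  measurable_fun [set: R] f ->
  ~ {ae (@lebesgue_measure R), forall x, f x = 0} ->
  exists a m : R, [/\ 0 < a, 0 < m &
    (m%:E < \int[@lebesgue_measure R]_(y in ball 0%R a) `|f y|%:E)%E].
Proof.
move=> mf f0; apply: contrapT => H; apply: f0.
have mnf : measurable_fun setT (fun y => `|f y|%:E).
  by apply/measurable_EFinP; exact: measurableT_comp.
have I0 n : (\int[@lebesgue_measure R]_(y in ball 0%R n%:R) `|f y|%:E = 0)%E.
  apply/eqP; rewrite eq_le integral_ge0 ?andbT//.
  rewrite leNgt; apply/negP => Ipos; apply: H.
  have [n0|n0] := ltP 0 (n%:R : R); last first.
    by move: Ipos; rewrite (ball0 _ _).2// integral_set0 ltxx.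
  move: Ipos; case E : (integral _ _ _) => [I| |]//; last first.
    by move=> _; exists n%:R, 1; rewrite E ltry.
  rewrite lte_fin => I0; exists n%:R, (I / 2); rewrite E lte_fin; split => //.
    by rewrite divr_gt0.
  by rewrite ltr_pdivrMr// ltr_pMr// ltr1n.
have cover : \bigcup_n ball (0 : R) n%:R = [set: R].
  apply/seteqP; split => // y _; near \oo => n; exists n => //.
  rewrite /ball/= sub0r normrN; near: n; exact: nbhs_infty_gtr.
have cvI : (\int[@lebesgue_measure R]_(y in ball 0%R n%:R) `|f y|%:E)%E
    @[n --> \oo] --> (\int[@lebesgue_measure R]_y `|f y|%:E)%E.
  rewrite -cover; apply: ge0_nondecreasing_set_cvg_integral => //.
  - apply/nondecreasing_seqP => n; rewrite subsetEset; apply: le_ball.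
    by rewrite ler_nat.
  - by move=> n; exact: measurable_ball.
  - by move=> n; exact: measurable_funTS.
have IT : (\int[@lebesgue_measure R]_y `|f y|%:E = 0)%E.
  apply: (cvg_unique _ cvI) => //.
  by apply: cvg_near_cst; apply: nearW => n; exact: I0.
have mfE : measurable_fun setT (EFin \o f) by exact/measurable_EFinP.
have /(_ IT) := (ae_eq_integral_abs (@lebesgue_measure R) measurableT mfE).1.
by apply: filterS => y /(_ I)[].
Unshelve. all: by end_near. Qed.

(** * Points with small frequency *)

(** With k := (1 - 1/C)/2 the number 1 - k lies strictly between 1/C and 1:
    a frequency at most |x|/C leaves room for a radius up to (1 - k)|x|, and
    such a radius keeps the window at distance k|x| from the origin. The factor
    12 N/m is the constant 3 of the weak-type inequality divided by the level
    m/(4N). *)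
Lemma measure_small_frequency_le (R : realType) (f : R -> R) (C a m d N : R) :
  (@lebesgue_measure R).-integrable [set: R] (EFin \o f) -> 1 < C ->
  0 < m -> (m%:E < \int[@lebesgue_measure R]_(y in ball 0%R a) `|f y|%:E)%E ->
  0 < d -> 0 < N -> a <= d * N ->
  (@lebesgue_measure R
     [set x : R | `|x| <= N /\ frequency_function f x <= `|x| / C]%R
   <= (2 * d * N)%:E + (12 * N / m)%:E * \int[@lebesgue_measure R]_x
     (`|(f \_ (~` ball 0%R ((1 - C^-1) / 2 * d * N)%R)) x|)%:E)%E.
Proof.
move=> intf C1 m0 am d0 N0 adN.
set k := (1 - C^-1) / 2; set D := ~` ball _ _.
have C0 : 0 < C by exact: lt_trans C1.
have C1' : C^-1 < 1 by rewrite invf_lt1.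
have Ci0 : 0 < C^-1 by rewrite invr_gt0.
have k0 : 0 < k by rewrite /k; lra.
have kC : C^-1 < 1 - k by rewrite /k; lra.
have dN0 : 0 < d * N by rewrite mulr_gt0.
have mf : measurable_fun setT f by case/integrableP : intf => /measurable_EFinP.
have mD : measurable D by apply: measurableC; exact: measurable_ball.
have intfD : (@lebesgue_measure R).-integrable [set: R] (EFin \o (f \_ D)).
  by rewrite -restrict_EFin; apply/integrable_restrict => //; rewrite setTI;
    exact: integrableS intf.
apply: (@le_trans _ _ (@lebesgue_measure R
    (ball (0 : R) (d * N) `|`
     [set x | HL_maximal (f \_ D) x > (m / (4 * N))%:E]%E))).
  apply: lebesgue_measure_le => x /= [xN fx].
  have [dx|xd] := leP (d * N) `|x|; last first.
    by left; rewrite /ball/= sub0r normrN.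
  right.
  have x0 : 0 < `|x| by exact: lt_le_trans dx.
  have lM := HL_maximal_lower_bound mf x0 (le_trans adN dx) am.
  have l0 : 0 < m / (4 * `|x|) by rewrite divr_gt0// mulr_gt0.
  have rho0 : 0 < (1 - k) * `|x| by rewrite mulr_gt0//; lra.
  have frho : frequency_function f x < (1 - k) * `|x|.
    by apply: (le_lt_trans fx); rewrite mulrC ltr_pM2r.
  have [r [r0 rrho lr]] := small_radius intf l0 rho0 frho lM.
  apply: (@le_lt_trans _ _ (m / (4 * `|x|))%:E).
    rewrite lee_fin ler_pM2l// lef_pV2 ?posrE ?mulr_gt0// ler_pM2l//.
  apply: (lt_le_trans lr); apply: average_restrict_le_HL => //.
  move=> y /=; rewrite in_itv/= => /andP[xry yxr].
  rewrite /D /setC/= /ball/= sub0r normrN; apply/negP; rewrite -leNgt.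
  have kdx : k * d * N <= k * `|x| by rewrite -mulrA ler_pM2l.
  have xyr : `|x - y| <= r by rewrite ler_norml; apply/andP; split; lra.
  have := lerB_dist x y.
  lra.
apply: le_trans (outer_measureU2 (mu_ext (@wlength R idfun)) _ _) _.
apply: leeD.
  rewrite [leLHS](lebesgue_measure_ball 0 (ltW dN0)) lee_fin mulr2n; lra.
have locD : locally_integrable setT (f \_ D).
  by apply: open_integrable_locally => //; exact: openT.
have c0 : 0 < m / (4 * N) by rewrite divr_gt0// mulr_gt0.
apply: le_trans (maximal_inequality locD c0) _.
rewrite (_ : 3 / (m / (4 * N)) = 12 * N / m)//.
by field; rewrite !gt_eqF.
Qed.

Theorem theorem3 (R : realType) (f : R -> R) (C : R)
    (hf : (@lebesgue_measure R).-integrable [set: R] (EFin \o f))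
    (hf0 : ~ {ae (@lebesgue_measure R), forall x, f x = 0})
    (hC : 1 < C) :
  (@lebesgue_measure R
      [set x : R | `|x| <= N%:R /\ frequency_function f x <= `|x| / C]%R
    * (N%:R^-1)%:E)%E @[N --> \oo] --> 0%E.
Proof.
have mf : measurable_fun setT f by case/integrableP : hf => /measurable_EFinP.
have [a [m [a0 m0 am]]] := ball_with_positive_mass mf hf0.
set u := (X in X @ _ --> _).
have u0 N : (0 <= u N)%E.
  by rewrite /u mule_ge0// ?lee_fin ?invr_ge0.
suff ue e : 0 < e -> \forall N \near \oo, (u N <= e%:E)%E.
  apply/fine_cvgP; split.
    near=> N; rewrite ge0_fin_numE//.
    apply: (@le_lt_trans _ _ 1%:E); last exact: ltry.
    by near: N; exact: ue.
  apply/cvgrPdist_le => e e0; near=> N.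
  have uNe : (u N <= e%:E)%E by near: N; exact: ue.
  rewrite sub0r normrN ger0_norm ?fine_ge0// -lee_fin fineK//.
  by rewrite ge0_fin_numE// (le_lt_trans uNe)// ltry.
move=> e0.
set k := (1 - C^-1) / 2.
have k0 : 0 < k.
  by rewrite divr_gt0// subr_gt0 invf_lt1// (lt_trans _ hC).
have d0 : 0 < e / 4 by rewrite divr_gt0.
have me0 : 0 < e / 2 / (12 / m) by rewrite !divr_gt0.
have /fine_cvgP[tailfin /cvgrPdist_le/(_ _ me0) tail_le] :=
  tail_integral_cvg0 (mulr_gt0 k0 d0) hf.
near=> N.
have N0 : 0 < N%:R :> R by near: N; exact: nbhs_infty_gtr.
have aN : a <= e / 4 * N%:R.
  by rewrite -ler_pdivrMl//; near: N; exact: nbhs_infty_ger.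
have := measure_small_frequency_le hf hC m0 am d0 N0 aN; rewrite -/k.
set I := (\int[_]_x _)%E => muN.
have Ifin : I \is a fin_num by rewrite /I; near: N; exact: tailfin.
have Ie : (I <= (e / 2 / (12 / m))%:E)%E.
  rewrite -(fineK Ifin) lee_fin (le_trans (ler_norm _))//.
  by rewrite -normrN -sub0r /I; near: N; exact: tail_le.
rewrite /u lee_pdivrMr//.
apply: (le_trans muN).
apply: (@le_trans _ _
    ((2 * (e / 4) * N%:R)%:E + (12 * N%:R / m)%:E * (e / 2 / (12 / m))%:E)%E).
  by rewrite leeD2l// lee_pmul2l// lte_fin divr_gt0// mulr_gt0.
(* with d = e/4 each of the two terms equals (e/2) N *)
rewrite -!EFinM -EFinD lee_fin le_eqVlt; apply/orP; left; apply/eqP.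
by field; rewrite gt_eqF.
Unshelve. all: by end_near. Qed.
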